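(* Let $d$ be a nonnegative integer and let $G$ be an abelian group of order $2^{2d+2}$, rank at least $d+1$, and exponent at most $2^{d+1}$. Then $G$ contains a reduced linking system of difference sets of size $3$, that is, a reduced $\left(2^{2d+2},\,2^d(2^{d+1}-1),\,2^d(2^d-1),\,2^{2d};\,3\right)$-linking system of difference sets.
   Context: Groups are written multiplicatively. For a group $G$ of order $v$, a subset $D\subseteq G$ with $k$ elements is a $(v,k,\lambda,n)$-difference set in $G$ if the multiset $\{d_1d_2^{-1} : d_1,d_2\in D,\ d_1\neq d_2\}$ contains every non-identity element of $G$ exactly $\lambda$ times, where $n:=k-\lambda$. A subset $S$ of $G$ is identified with the element $\sum_{s\in S}s$ of the group ring $\mathbb{Z}[G]$, and $S^{(-1)}:=\sum_{s\in S}s^{-1}$. For $\ell\ge 2$, a collection $\{D_1,\dots,D_\ell\}$ of size $\ell$ of $(v,k,\lambda,n)$-difference sets in $G$ is a reduced $(v,k,\lambda,n;\ell)$-linking system of difference sets in $G$ of size $\ell$ if there are integers $\mu,\nu$ such that for all distinct $i,j$ there is some $(v,k,\lambda,n)$-difference set $D(i,j)$ in $G$ (not necessarily one of the $D_r$) with $D_iD_j^{(-1)}=(\mu-\nu)D(i,j)+\nu G$ in $\mathbb{Z}[G]$. The rank of an abelian 2-group isomorphic to $\mathbb{Z}_{2^{a_1}}\times\cdots\times\mathbb{Z}_{2^{a_t}}$ with all $a_i\ge 1$ is $t$. The exponent of $G$ is the smallest positive integer $\alpha$ with $g^\alpha=1_G$ for all $g\in G$. *)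

(* Defs.v *)
From HB Require Import structures.
From mathcomp Require Import all_boot all_order all_algebra all_fingroup all_solvable.

Set Implicit Arguments.
Unset Strict Implicit.
Unset Printing Implicit Defensive.

Import GRing.Theory.
Local Open Scope ring_scope.

(* The integral group ring Z[gT]: coefficient functions gT -> int. The Zmodule
   structure is pointwise, the product is convolution.  For G : {group gT},
   Z[G] is the subring of elements supported in G. *)
Definition group_ring (gT : finGroupType) : Type := {ffun gT -> int}.

HB.instance Definition _ (gT : finGroupType) :=
  GRing.Zmodule.copy (group_ring gT) {ffun gT -> int}.

Section GroupRing.
Variable gT : finGroupType.
Implicit Types (x y : gT) (f g h : group_ring gT).

Definition gr_elt x : group_ring gT := [ffun y => (y == x)%:R].

Definition gr_mul f g : group_ring gT :=
  [ffun x => \sum_(y : gT) f y * g (y^-1 * x)%g].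

Lemma gr_mulA : associative gr_mul.
Proof.
move=> f g h; apply/ffunP=> x; rewrite !ffunE.
under eq_bigr => y _ do rewrite ffunE big_distrr /=.
under [RHS]eq_bigr => y _ do rewrite ffunE big_distrl /=.
rewrite [RHS]exchange_big /=; apply: eq_bigr => y _.
rewrite [RHS](reindex_inj (mulgI y)) /=; apply: eq_bigr => z _.
by rewrite mulKg invMg mulrA mulgA.
Qed.

Lemma gr_mul1l : left_id (gr_elt 1) gr_mul.
Proof.
move=> f; apply/ffunP=> x; rewrite !ffunE (bigD1 1%g) //= ffunE eqxx mul1r.
rewrite invg1 mul1g big1 ?addr0 // => y /negPf yN1.
by rewrite ffunE yN1 mul0r.
Qed.

Lemma gr_mul1r : right_id (gr_elt 1) gr_mul.
Proof.
move=> f; apply/ffunP=> x; rewrite !ffunE (bigD1 x) //= ffunE mulVg eqxx mulr1.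
rewrite big1 ?addr0 // => y /negPf yNx.
by rewrite ffunE -eq_mulVg1 yNx mulr0.
Qed.

Lemma gr_mulDl : left_distributive gr_mul +%R.
Proof.
move=> f g h; apply/ffunP=> x; rewrite !ffunE -big_split /=.
by apply: eq_bigr => y _; rewrite ffunE mulrDl.
Qed.

Lemma gr_mulDr : right_distributive gr_mul +%R.
Proof.
move=> f g h; apply/ffunP=> x; rewrite !ffunE -big_split /=.
by apply: eq_bigr => y _; rewrite ffunE mulrDr.
Qed.

Lemma gr_1neq0 : gr_elt 1 != 0.
Proof. by apply/eqP => /ffunP/(_ 1%g); rewrite !ffunE eqxx. Qed.

End GroupRing.

HB.instance Definition _ (gT : finGroupType) :=
  GRing.Zmodule_isNzRing.Build (group_ring gT) (@gr_mulA gT) (@gr_mul1l gT)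
    (@gr_mul1r gT) (@gr_mulDl gT) (@gr_mulDr gT) (@gr_1neq0 gT).

Section DifferenceSets.
Variable gT : finGroupType.
Implicit Types (G : {group gT}) (S D : {set gT}).

Definition gr_set S : group_ring gT := \sum_(s in S) gr_elt s.

(* S^(-1) *)
Definition gr_setV S : group_ring gT := \sum_(s in S) gr_elt s^-1%g.

(* The subtraction defining n is in int. *)
Definition difference_set (v k lambda n : nat) G D : Prop :=
  [/\ #|G| = v, D \subset G, #|D| = k, n%:Z = k%:Z - lambda%:Z &
      forall g, g \in G^#%g ->
        #|[set p in setX D D | (p.1 != p.2) && (p.1 * p.2^-1 == g)%g]|
          = lambda].

Definition reduced_linking_system (v k lambda n l : nat) G
    (DD : {set {set gT}}) : Prop :=
  [/\ (2 <= l)%N, #|DD| = l,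
      forall D, D \in DD -> difference_set v k lambda n G D &
      exists mu nu : int, forall Di Dj, Di \in DD -> Dj \in DD -> Di != Dj ->
        exists2 Dij : {set gT}, difference_set v k lambda n G Dij &
          gr_set Di * gr_setV Dj = gr_set Dij *~ (mu - nu) + gr_set G *~ nu].

End DifferenceSets.

(* The rank of an abelian 2-group, i.e. its number of factors in a
   decomposition into nontrivial cyclic groups, is the library's 'r(G). *)
Lemma rank_dprod_cycles (gT : finGroupType) (G : {group gT}) (b : seq gT) :
    abelian G -> 2.-group%g G -> (\big[dprod/1]_(x <- b) <[x]> = G)%g ->
  1%g \notin b -> 'r(G)%g = size b.
Proof.
move=> cGG pG defG ntb.
rewrite -(size_abelian_type cGG) (perm_size (abelian_type_pgroup pG defG ntb)).
by rewrite size_map.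
Qed.

(* Main.v *)
Require Import Defs.
From mathcomp Require Import all_boot all_order all_algebra all_fingroup all_solvable.
From mathcomp Require Import mxabelem zify ring.

Set Implicit Arguments.
Unset Strict Implicit.
Unset Printing Implicit Defensive.

(** Let E be an elementary abelian subgroup of G of order 2^(d+1), and let
    chi_t be its 2^(d+1) characters with values 1 and -1, extended by 0 to G.
    A transversal u = (u_t) of E in G, indexed by the same t, gives the element
    S_u = sum_t u_t chi_t of Z[G], whose coefficients on G are 1 and -1. Since
    chi_t chi_s is |E| chi_t or 0 according as t = s or not, and sum_t chi_t is
    |E| times the identity,

        S_u S_v^(-1) = |E| S_{u/v}   and   S_u S_u^(-1) = |E|^2,

    where u/v is the family of the u_t v_t^-1. Let D_u be the set where S_u is
    -1, so that S_u = G - 2 D_u. The second identity says that D_u is a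
    difference set with the required parameters
    ([twisted_set_difference_set]); the first says that, as soon as u/v is a
    transversal too, D_u D_v^(-1) is an integral combination of D_{u/v} and G
    ([twisted_set_link]). A linking system of size 3 therefore comes from three
    transversals whose pairwise quotients are transversals: with the constant
    family 1 as a first row, this is a 4-row difference matrix over G/E
    ([linking_system_of_difference_matrix]).

    Such a matrix exists over every noncyclic abelian 2-group
    ([difference_matrix_noncyclic]). Matrices over K and over G/K combine into
    one over G ([difference_matrix_trans]), and every noncyclic abelian 2-group
    can be dismantled into sections that are elementary abelian of order 8 or
    of the form Z_{2^a} x Z_2; over these, matrices are given by explicit
    formulas ([difference_matrix_by_2_2_2], [difference_matrix_cyclic_by_2]).

    It remains to choose E so that G/E is noncyclic. If x has maximal order in
    G, it is enough that E contains the involution of <[x]>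
    ([noncyclic_quotient]), which the rank hypothesis permits when d > 0. When
    d = 0 the quotient G/E has order 2 and no choice works, but then the
    difference sets are singletons and any three of them will do. *)

(** * Difference matrices with four rows *)

Section DifferenceMatrices.
Local Open Scope group_scope.
Variable gT : finGroupType.
Implicit Types (G K L H : {group gT}) (x y z : gT).

(** With #|T| * #|K| = #|G| this makes [u] a transversal of [K] in [G]; keeping
    the count apart lets the condition pass through quotients and products
    without any bookkeeping. *)
Definition separates (G K : {set gT}) (T : Type) (u : T -> gT) : Prop :=
  (forall t, u t \in G) /\ (forall t t', u t * (u t')^-1 \in K -> t = t').

(** A difference matrix over G/K with four rows and columns indexed by [T],
    normalised by making the first row constantly 1 and leaving it out. *)
Definition difference_matrix (G K : {set gT}) (T : finType)
    (f : 'I_3 -> T -> gT) : Prop :=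
  [/\ (#|T| * #|K|)%N = #|G|, forall i, separates G K (f i)
    & forall i j, i != j -> separates G K (fun t => f i t * (f j t)^-1)].

Definition has_difference_matrix (G K : {set gT}) : Prop :=
  exists (T : finType) (f : 'I_3 -> T -> gT), difference_matrix G K f.

Lemma eq_separates (G K : {set gT}) T (u v : T -> gT) :
  u =1 v -> separates G K u -> separates G K v.
Proof.
by move=> uv [uG uK]; split=> [t|t t']; rewrite -!uv //; exact: uK.
Qed.

Lemma abelian_mulgACA G a b c d : abelian G ->
  a \in G -> b \in G -> c \in G -> d \in G -> a * b * (c * d) = a * c * (b * d).
Proof.
move=> /centsP cGG aG bG cG dG.
by rewrite -!mulgA; congr (_ * _); rewrite !mulgA (cGG b bG c cG).
Qed.

Lemma abelian_divgACA G a b c d : abelian G ->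
    a \in G -> b \in G -> c \in G -> d \in G ->
  a * b * (c * d)^-1 = a * c^-1 * (b * d^-1).
Proof.
move=> cGG aG bG cG dG; have /centsP comG := cGG.
by rewrite (comG c cG d dG) invMg (abelian_mulgACA cGG) ?groupV.
Qed.

Lemma separates_inv G K T (u v : T -> gT) : abelian G -> K \subset G ->
    (forall t, u t \in G) -> (forall t, v t \in G) ->
    separates G K (fun t => u t * (v t)^-1) ->
  separates G K (fun t => v t * (u t)^-1).
Proof.
move=> cGG sKG uG vG [_ hK]; split=> [t|t t' h].
  by rewrite groupM ?groupV.
symmetry; apply: hK.
have e a b : (u a * (v a)^-1) * (u b * (v b)^-1)^-1 =
    (v b * (u b)^-1) * (v a * (u a)^-1)^-1.
  rewrite !invMg !invgK.
  have /centsP c := cGG.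
  by rewrite (c (u a * (v a)^-1)) ?(groupM, groupV).
by rewrite e.
Qed.

(** Transposing a quotient of two rows inverts it, so only three of the six
    ordered pairs of rows need to be looked at. *)
Lemma difference_matrix3 G K (T : finType) (u v w : T -> gT) :
    abelian G -> K \subset G -> (#|T| * #|K|)%N = #|G| ->
    separates G K u -> separates G K v -> separates G K w ->
    separates G K (fun t => v t * (u t)^-1) ->
    separates G K (fun t => w t * (u t)^-1) ->
    separates G K (fun t => w t * (v t)^-1) ->
  has_difference_matrix G K.
Proof.
move=> cGG sKG cT hu hv hw hvu hwu hwv.
exists T, (fun i => nth u [:: u; v; w] i); split=> //.
  by case=> [[|[|[|m]]] ltm].
have [[uG _] [[vG _] [wG _]]] := (hu, (hv, hw)).
by case=> [[|[|[|m]]] ltm] [[|[|[|n]]] ltn] //= _; apply: separates_inv.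
Qed.

(** The columns of the new matrix are the products of a column modulo [K] and a
    column inside [K]: the first factor is recovered modulo [K], and once it is
    known the second one is recovered modulo [L]. *)
Lemma difference_matrix_trans K G L : abelian G -> K \subset G -> L \subset K ->
  has_difference_matrix G K -> has_difference_matrix K L ->
  has_difference_matrix G L.
Proof.
move=> cGG sKG sLK [T [f [cT fK fKK]]] [U [g [cU gL gLL]]].
have comp (u : T -> gT) (v : U -> gT) : separates G K u -> separates K L v ->
    separates G L (fun p : T * U => u p.1 * v p.2).
  move=> [uG hu] [vK hv]; have vG s : v s \in G by rewrite (subsetP sKG).
  split=> [t|[t s] [t' s'] /=]; first by rewrite groupM.
  rewrite (abelian_divgACA cGG) // => h.
  have tt' : t = t'.
    apply: hu; have := subsetP sLK _ h; rewrite groupMr //.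
    by rewrite groupM ?groupV.
  by move: h; rewrite tt' mulgV mul1g => /hv->.
exists (T * U)%type, (fun i p => f i p.1 * g i p.2); split=> [|i|i j ij].
- by rewrite card_prod -mulnA cU.
- exact: comp.
have fG k t : f k t \in G by case: (fK k).
have gG k s : g k s \in G by apply: (subsetP sKG); case: (gL k).
apply: eq_separates (comp _ _ (fKK i j ij) (gLL i j ij)) => p /=.
by rewrite (abelian_divgACA cGG).
Qed.

Lemma difference_matrix_dprod (A B G : {group gT}) : A \x B = G -> abelian G ->
  has_difference_matrix A 1 -> has_difference_matrix G B.
Proof.
move=> defG cGG [T [f [cT fK fKK]]]; have [_ defAB _ tiAB] := dprodP defG.
have sAG : A \subset G by rewrite -defAB mulG_subl.
have lift (u : T -> gT) : separates A 1 u -> separates G B u.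
  move=> [uA hu]; split=> [t|t t' h]; first by rewrite (subsetP sAG).
  by apply: hu; rewrite -tiAB inE h groupM ?groupV.
exists T, f; split=> [|i|i j ij]; try exact: lift; last exact/lift/fKK.
by rewrite -(dprod_card defG) -cT cards1 muln1.
Qed.

(** The explicit matrices have entries x^i y^j z^k. Working with the triples of
    natural exponents, and moving denominators to the other side, turns every
    condition on them into congruences without subtraction. *)
Definition word3 x y z (p : nat * nat * nat) : gT :=
  x ^+ p.1.1 * y ^+ p.1.2 * z ^+ p.2.

Definition add3 (p q : nat * nat * nat) : nat * nat * nat :=
  (p.1.1 + q.1.1, p.1.2 + q.1.2, p.2 + q.2)%N.

Definition cong3 (A B C : nat) (p q : nat * nat * nat) : Prop :=
  [/\ p.1.1 = q.1.1 %[mod A], p.1.2 = q.1.2 %[mod B] & p.2 = q.2 %[mod C]].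

Definition independent_mod (K : {set gT}) x y z (A B C : nat) : Prop :=
  forall i j k : nat, x ^+ i * y ^+ j * z ^+ k \in K ->
    [/\ (A %| i)%N, (B %| j)%N & (C %| k)%N].

Lemma modn_of_expgV (a o p q : nat) : (0 < o)%N -> (a %| o)%N ->
  (a %| p + o.-1 * q)%N -> p = q %[mod a].
Proof.
case: o => // o _ /= /eqP/= d1 /eqP/= d2.
rewrite -[in LHS](addn0 p) -(modnDmr p 0).
have -> : 0 %% a = (o.+1 * q) %% a by rewrite -modnMml d1 mul0n.
by rewrite modnDmr mulSn addnCA -modnDmr d2 addn0.
Qed.

Lemma word3_cong G K x y z A B C : abelian G -> K \subset G ->
    x \in G -> y \in G -> z \in G -> independent_mod K x y z A B C ->
  forall p q, word3 x y z p * (word3 x y z q)^-1 \in K -> cong3 A B C p q.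
Proof.
move=> cGG sKG xG yG zG indK [[i j] k] [[i' j'] k'].
have [xX yX zX] : [/\ forall n, x ^+ n \in G, forall n, y ^+ n \in G
    & forall n, z ^+ n \in G] by split=> n; apply: groupX.
have xyX m n : x ^+ m * y ^+ n \in G by apply: groupM.
rewrite /word3 /= !(abelian_divgACA cGG) // -!expVgn !invg_expg -!expgM.
rewrite -!expgD.
have dx : (A %| #[x])%N.
  by case: (indK #[x] 0 0) => //; rewrite expg_order !expg0 !mulg1 group1.
have dy : (B %| #[y])%N.
  by case: (indK 0 #[y] 0) => //; rewrite expg_order !expg0 !mulg1 group1.
have dz : (C %| #[z])%N.
  by case: (indK 0 0 #[z]) => //; rewrite expg_order !expg0 !mulg1 group1.
by move=> /indK[di dj dk]; split=> /=;
  [move: di | move: dj | move: dk]; apply: modn_of_expgV.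
Qed.

Lemma difference_matrix_word3 G K x y z A B C (T : finType)
    (e1 e2 e3 : T -> nat * nat * nat) :
    abelian G -> K \subset G -> (#|T| * #|K|)%N = #|G| ->
    x \in G -> y \in G -> z \in G -> independent_mod K x y z A B C ->
    (forall t t', cong3 A B C (e1 t) (e1 t') -> t = t') ->
    (forall t t', cong3 A B C (e2 t) (e2 t') -> t = t') ->
    (forall t t', cong3 A B C (e3 t) (e3 t') -> t = t') ->
    (forall t t', cong3 A B C (add3 (e2 t) (e1 t')) (add3 (e2 t') (e1 t)) ->
      t = t') ->
    (forall t t', cong3 A B C (add3 (e3 t) (e1 t')) (add3 (e3 t') (e1 t)) ->
      t = t') ->
    (forall t t', cong3 A B C (add3 (e3 t) (e2 t')) (add3 (e3 t') (e2 t)) ->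
      t = t') ->
  has_difference_matrix G K.
Proof.
move=> cGG sKG cT xG yG zG indK h1 h2 h3 h21 h31 h32.
have wG p : word3 x y z p \in G by rewrite !groupM ?groupX.
have cK := word3_cong cGG sKG xG yG zG indK.
have wD p q : word3 x y z (add3 p q) = word3 x y z p * word3 x y z q.
  have X w n : w \in G -> w ^+ n \in G by apply: groupX.
  rewrite /word3 /= !expgD (abelian_mulgACA (b := z ^+ _) cGG) ?groupM ?X //.
  by rewrite (abelian_mulgACA (a := x ^+ _) (b := y ^+ _) cGG) ?X.
have sep e : (forall t t', cong3 A B C (e t) (e t') -> t = t') ->
    separates G K (fun t : T => word3 x y z (e t)).
  by move=> h; split=> // t t' /cK/h.
have sepV e e' : (forall t t',
      cong3 A B C (add3 (e t) (e' t')) (add3 (e t') (e' t)) -> t = t') ->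
    separates G K (fun t : T => word3 x y z (e t) * (word3 x y z (e' t))^-1).
  move=> h; split=> [t|t t' hK]; first by rewrite groupM ?groupV.
  apply/h/cK; rewrite !wD (abelian_divgACA cGG) //.
  move: hK; rewrite (abelian_divgACA cGG) ?groupV // invgK.
  have /centsP c := cGG.
  by rewrite (c (word3 x y z (e' t))^-1) ?groupV.
by apply: (difference_matrix3 cGG sKG cT (sep e1 _) (sep e2 _) (sep e3 _)
  (sepV e2 e1 _) (sepV e3 e1 _) (sepV e3 e2 _)).
Qed.

(** The value 2c + e modulo 2M determines the bit e by parity and then c modulo
    M; the missing top bit of c is the one given by the comparison with M. *)
Lemma eq_of_double_mod (M N c c' : nat) (e e' : bool) :
    N = (M * 2)%N -> (0 < M)%N -> (c < N)%N -> (c' < N)%N ->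
    (c * 2 + e = c' * 2 + e' %[mod N])%N -> (M <= c)%N = (M <= c')%N ->
  c = c' /\ e = e'.
Proof.
move=> -> M0 lc lc' E h.
have ee : e = e'.
  move/(congr1 (modn^~ 2)): E; rewrite !modn_dvdm ?dvdn_mull //.
  by rewrite !modnMDl => /eqP; move: e e' => [] []; vm_compute.
split=> //; move: E; rewrite ee; move/eqP; rewrite eqn_modDr => /eqP.
rewrite -!muln_modl => /eqP; rewrite eqn_pmul2r // => /eqP.
have red d : (d < M * 2)%N -> d %% M = if M <= d then (d - M)%N else d.
  case: (leqP M d) => [le_Md lt_d|lt_d _]; last by rewrite modn_small.
  have lt_dM : (d - M < M)%N by lia.
  by rewrite -[in LHS](subnK le_Md) modnDr modn_small.
by rewrite !red // -h; case: (leqP M c) => [le_Mc|//] E; lia.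
Qed.

Lemma eq_of_triple_mod (a c c' : nat) :
  (c < 2 ^ a)%N -> (c' < 2 ^ a)%N -> 3 * c = 3 * c' %[mod 2 ^ a] -> c = c'.
Proof.
have main d d' : (d < 2 ^ a)%N -> (d' <= d)%N ->
    3 * d = 3 * d' %[mod 2 ^ a] -> d = d'.
  move=> ld le /eqP; rewrite eqn_mod_dvd ?leq_mul2l ?le ?orbT // -mulnBr.
  rewrite Gauss_dvdr ?coprimeXl // => dv.
  by have := dvdn_leq _ dv; have := leq_trans (leq_subr d' d) (ltnW ld); lia.
move=> lc lc' E; case: (leqP c' c) => [|/ltnW] le; first exact: main.
by symmetry; apply: main.
Qed.

(** Columns are pairs (c, e) of a residue c modulo 2^(a+1) and a bit e; let h be
    the top bit of c. In Z_{2^(a+1)} x Z_2 the rows are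

        (c + e, e),   (2c + e, h),   (3c, h + e)

    and their pairwise differences are (c, h + e), (2c - e, h), (c - e, e). Each
    of these six maps either has a component that is a unit multiple of c, or
    is e itself, so that the other one is then known too; or it has the form
    (2c + e, h) or (2c - e, h) and is injective because h restores the bit of c
    lost by doubling. *)
Lemma difference_matrix_cyclic_by_2 G K x y a :
    abelian G -> K \subset G -> x \in G -> y \in G ->
    (forall i j, x ^+ i * y ^+ j \in K -> (2 ^ a.+1 %| i)%N /\ (2 %| j)%N) ->
    (2 ^ a.+1 * 2 * #|K|)%N = #|G| ->
  has_difference_matrix G K.
Proof.
move=> cGG sKG xG yG indK cG.
pose h (c : 'I_(2 ^ a.+1)) : bool := (2 ^ a <= c)%N.
pose N := (2 ^ a.+1)%N.
have N2 : N = (2 ^ a * 2)%N by rewrite /N expnSr.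
have M0 : (0 < 2 ^ a)%N by rewrite expn_gt0.
have small (c c' : 'I_N) : c = c' %[mod N] -> c = c'.
  by rewrite !modn_small // => /val_inj.
apply: (@difference_matrix_word3 G K x y 1 N 2 1 ('I_N * bool)%type
  (fun t => (t.1 + t.2, nat_of_bool t.2, 0)%N)
  (fun t => (t.1 * 2 + t.2, nat_of_bool (h t.1), 0)%N)
  (fun t => (3 * t.1, h t.1 + t.2, 0)%N)) => //.
- by rewrite card_prod card_ord card_bool.
- by move=> i j k; rewrite expg1n mulg1 => /indK[]; split.
- move=> [c e] [c' e'] [/= h1 /eqP h2 _].
  have ee : e = e' by clear h1; move: e e' h2 => [] []; vm_compute.
  by move/eqP: h1; rewrite ee eqn_modDr => /eqP/small->.
- move=> [c e] [c' e'] [/= h1 /eqP h2 _].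
  have hh : h c = h c' by clear h1; move: (h c) (h c') h2 => [] []; vm_compute.
  by have [/val_inj -> ->] :=
    eq_of_double_mod N2 M0 (ltn_ord c) (ltn_ord c') h1 hh.
- move=> [c e] [c' e'] [/= h1 /eqP h2 _].
  have cc : c = c' by apply/val_inj/(eq_of_triple_mod _ _ h1).
  by move: h2; rewrite cc; clear h1; move: (h c') e e' => [] [] []; vm_compute.
- move=> [c e] [c' e'] [/= h1 /eqP h2 _].
  have cc : c = c'.
    apply/small/eqP; rewrite -(eqn_modDr (c + c' + e + e')); apply/eqP.
    by move: h1; congr (_ %% _ = _ %% _); lia.
  by move: h2; rewrite cc; clear h1; move: (h c') e e' => [] [] []; vm_compute.
- move=> [c e] [c' e'] [/= h1 /eqP h2 _].
  have hh : h c = h c'.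
    by clear h1; move: (h c) (h c') e e' h2 => [] [] [] []; vm_compute.
  have E : (c * 2 + e' = c' * 2 + e %[mod N])%N.
    apply/eqP; rewrite -(eqn_modDr (c + c')); apply/eqP.
    by move: h1; congr (_ %% _ = _ %% _); lia.
  by have [/val_inj -> ->] :=
    eq_of_double_mod N2 M0 (ltn_ord c) (ltn_ord c') E hh.
move=> [c e] [c' e'] [/= h1 /eqP h2 _].
have ee : e = e'.
  by clear h1; move: (h c) (h c') e e' h2 => [] [] [] []; vm_compute.
rewrite ee; congr (_, _); apply/small/eqP.
rewrite -(eqn_modDr (2 * c + 2 * c' + e')); apply/eqP.
by move: h1; rewrite ee; congr (_ %% _ = _ %% _); lia.
Qed.

(** Identify the section with the field F_2[w], w^3 = w + 1, by sending x, y, z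
    to 1, w, w^2. The rows are the multiplications by 1, w and w^2, whose
    differences are again multiplications by nonzero elements. *)
Lemma difference_matrix_by_2_2_2 G K x y z :
    abelian G -> K \subset G -> x \in G -> y \in G -> z \in G ->
    independent_mod K x y z 2 2 2 -> (8 * #|K|)%N = #|G| ->
  has_difference_matrix G K.
Proof.
move=> cGG sKG xG yG zG indK cG.
apply: (@difference_matrix_word3 G K x y z 2 2 2 (bool * bool * bool)%type
  (fun t => (nat_of_bool t.1.1, nat_of_bool t.1.2, nat_of_bool t.2))
  (fun t => (nat_of_bool t.2, t.1.1 + t.2, nat_of_bool t.1.2)%N)
  (fun t => (nat_of_bool t.1.2, t.1.2 + t.2, t.1.1 + t.2)%N)) => //.
- by rewrite !card_prod card_bool.
all: move=> [[i j] k] [[i' j'] k'] [/= /eqP h1 /eqP h2 /eqP h3].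
all: by move: i j k i' j' k' h1 h2 h3 => [] [] [] [] [] []; vm_compute.
Qed.

End DifferenceMatrices.

(** * Noncyclic abelian 2-groups *)

Section NoncyclicAbelian.
Local Open Scope group_scope.

Section Sections.
Variable gT : finGroupType.
Implicit Types (G K A B : {group gT}) (x y z : gT).

Lemma dprod_mem_mulg A B G (A' B' : {set gT}) a b : A \x B = G ->
    A' \subset A -> B' \subset B -> a \in A -> b \in B ->
  a * b \in A' * B' -> a \in A' /\ b \in B'.
Proof.
move=> defG sA sB aA bB /mulsgP[a' b' a'A b'B e].
have abG : a * b \in G by rewrite -(dprodW defG) mem_mulg.
have [u [v [_ _ _ uniq_uv]]] := mem_dprod defG abG.
have [-> ->] := uniq_uv a b aA bB erefl.
by have [<- <-] := uniq_uv a' b' (subsetP sA _ a'A) (subsetP sB _ b'B) e.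
Qed.

Lemma dprodS A B G A' B' : A \x B = G -> A' \subset A -> B' \subset B ->
  exists2 H : {group gT}, A' \x B' = H & H \subset G.
Proof.
move=> /dprodP[_ defG cAB tiAB] sA sB; exists (A' <*> B')%G; last first.
  rewrite join_subG -defG (subset_trans sA) ?mulG_subl //.
  exact: subset_trans sB (mulG_subr _ _).
apply: dprodEY; first exact: subset_trans sB (subset_trans cAB (centS sA)).
by apply/trivgP; rewrite -tiAB setISS.
Qed.

Lemma dvdn_expg_mem_cycle x m i : (m %| #[x])%N -> x ^+ i \in <[x ^+ m]> ->
  (m %| i)%N.
Proof.
move=> dm /cycleP[k]; rewrite -expgM => /eqP; rewrite eq_expg_mod_order => /eqP e.
by rewrite /dvdn -(modn_dvdm i dm) e modn_dvdm // modnMr.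
Qed.

Lemma sub_cycleX x m : <[x ^+ m]> \subset <[x]>.
Proof. by rewrite cycle_subG mem_cycle. Qed.

Lemma dprod2_expg_mem G x y m n i j : <[x]> \x <[y]> = G ->
    (m %| #[x])%N -> (n %| #[y])%N ->
  x ^+ i * y ^+ j \in <[x ^+ m]> * <[y ^+ n]> -> (m %| i)%N /\ (n %| j)%N.
Proof.
move=> defG dm dn /(dprod_mem_mulg defG (sub_cycleX x m) (sub_cycleX y n)).
case; rewrite ?mem_cycle // => hx hy.
by split; [apply: dvdn_expg_mem_cycle hx | apply: dvdn_expg_mem_cycle hy].
Qed.

Lemma order_expg2 x a : #[x] = (2 ^ a.+1)%N -> #[x ^+ 2] = (2 ^ a)%N.
Proof. by move=> ox; rewrite orderXdiv ox expnS ?dvdn_mulr // mulKn. Qed.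

Lemma cycle_expg_order x : <[x ^+ #[x]]> = 1.
Proof. by rewrite expg_order cycle1. Qed.

(** While both orders exceed 2, the section modulo <[x^2]> x <[y^2]> is
    Z_2 x Z_2, and the orders in the subgroup that remains have been halved. *)
Lemma difference_matrix_cycle2 G x y a b : abelian G -> <[x]> \x <[y]> = G ->
    #[x] = (2 ^ a.+1)%N -> #[y] = (2 ^ b.+1)%N -> has_difference_matrix G 1.
Proof.
have base (H : {group gT}) u v c : abelian H -> <[u]> \x <[v]> = H ->
    #[u] = (2 ^ c.+1)%N -> #[v] = 2 -> has_difference_matrix H 1.
  move=> cHH defH ou ov; have [_ defH' _ _] := dprodP defH.
  apply: (@difference_matrix_cyclic_by_2 _ H 1%G u v c) => //.
  - exact: sub1G.
  - by rewrite -defH' (subsetP (mulG_subl _ _)) ?cycle_id.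
  - by rewrite -defH' (subsetP (mulG_subr _ _)) ?cycle_id.
  - move=> i j uv1; rewrite -ou -ov.
    apply: (dprod2_expg_mem defH) => //.
    by rewrite !cycle_expg_order mulg1.
  - by rewrite -(dprod_card defH) -!orderE ou ov cards1 muln1.
elim: b G x y a => [|b IHb] G x y [|a] cGG defG ox oy.
- exact: base defG ox oy.
- exact: base defG ox oy.
- by rewrite dprodC in defG; apply: base defG oy ox.
have [K defK sKG] := dprodS defG (sub_cycleX x 2) (sub_cycleX y 2).
have cKK : abelian K := abelianS sKG cGG.
have [_ defG' _ _] := dprodP defG.
apply: (difference_matrix_trans cGG sKG (sub1G _)); last first.
  exact: IHb cKK defK (order_expg2 ox) (order_expg2 oy).
apply: (@difference_matrix_cyclic_by_2 _ G K x y 0) => //.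
- by rewrite -defG' (subsetP (mulG_subl _ _)) ?cycle_id.
- by rewrite -defG' (subsetP (mulG_subr _ _)) ?cycle_id.
- move=> i j; have [_ <- _ _] := dprodP defK.
  by apply: (dprod2_expg_mem defG); rewrite (ox, oy) expnS dvdn_mulr.
rewrite -(dprod_card defG) -(dprod_card defK) -!orderE.
rewrite (order_expg2 ox) (order_expg2 oy) ox oy !expnS; lia.
Qed.

(** Three factors cannot be paired off. If some order, say that of x, exceeds 2,
    then the section modulo <[x^2]> x <[z]> is Z_2 x <[y]> and leaves a group
    with two cyclic factors; otherwise the group is elementary of order 8. *)
Lemma difference_matrix_cycle3 G x y z a b c : abelian G ->
    <[x]> \x (<[y]> \x <[z]>) = G ->
    #[x] = (2 ^ a.+1)%N -> #[y] = (2 ^ b.+1)%N -> #[z] = (2 ^ c.+1)%N ->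
  has_difference_matrix G 1.
Proof.
(* The case of a first order exceeding 2; the others follow by permutation. *)
have step (H : {group gT}) u v w d e f : abelian H ->
    <[u]> \x (<[v]> \x <[w]>) = H -> #[u] = (2 ^ d.+2)%N ->
    #[v] = (2 ^ e.+1)%N -> #[w] = (2 ^ f.+1)%N -> has_difference_matrix H 1.
  move=> cHH defH ou ov ow; have [[_ R _ defR] defH' _ _] := dprodP defH.
  have [_ defR' _ _] := dprodP defR.
  rewrite defR in defH defH'.
  have sRH : R \subset H by rewrite -defH' mulG_subr.
  have swR : <[w]> \subset R by rewrite -defR' mulG_subr.
  have svR : <[v]> \subset R by rewrite -defR' mulG_subl.
  have [K defK sKH] := dprodS defH (sub_cycleX u 2) swR.
  have cKK : abelian K := abelianS sKH cHH.
  have uH : u \in H by rewrite -defH' (subsetP (mulG_subl _ _)) ?cycle_id.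
  have vR : v \in R by rewrite (subsetP svR) ?cycle_id.
  have vH : v \in H by rewrite (subsetP sRH).
  apply: (difference_matrix_trans cHH sKH (sub1G _)); last first.
    exact: difference_matrix_cycle2 cKK defK (order_expg2 ou) ow.
  apply: (@difference_matrix_cyclic_by_2 _ H K v u e) => //.
    move=> i j; rewrite (centsP cHH _ (groupX i vH) _ (groupX j uH)).
    have [_ <- _ _] := dprodP defK.
    move=> /(dprod_mem_mulg defH (sub_cycleX u 2) swR)[].
    - exact: mem_cycle.
    - exact: groupX.
    move=> hu hv; split; last first.
      by apply: dvdn_expg_mem_cycle hu; rewrite ou expnS dvdn_mulr.
    rewrite -ov; apply: (dvdn_expg_mem_cycle (x := v)) => //.
    rewrite cycle_expg_order.
    have [] // := dprod_mem_mulg (a := v ^+ i) (b := 1) defR (sub1G _) (subxx _).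
    - exact: mem_cycle.
    - by rewrite mulg1 mul1g.
  rewrite -(dprod_card defH) -(dprod_card defK) -!orderE.
  by rewrite -(dprod_card defR) -!orderE (order_expg2 ou) ou ov ow !expnS; lia.
move=> cGG defG ox oy oz; case: a ox => [|a] ox; last first.
  exact: step cGG defG ox oy oz.
case: b oy => [|b] oy; last first.
  apply: (step G y x z b 0 c) => //.
  by rewrite dprodA (dprodC <[y]>) -dprodA.
case: c oz => [|c] oz; last first.
  apply: (step G z x y c 0 0) => //.
  by rewrite dprodC -dprodA.
have [[_ R _ defR] defG' _ _] := dprodP defG.
have [_ defR' _ _] := dprodP defR; rewrite defR in defG defG'.
have sRG : R \subset G by rewrite -defG' mulG_subr.
have ix : x \in <[x]> by apply: cycle_id.
have yR : y \in R by rewrite -defR' (subsetP (mulG_subl _ _)) ?cycle_id.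
have zR : z \in R by rewrite -defR' (subsetP (mulG_subr _ _)) ?cycle_id.
apply: (@difference_matrix_by_2_2_2 _ G 1%G x y z) => //.
- exact: sub1G.
- by rewrite -defG' (subsetP (mulG_subl _ _)).
- exact: subsetP sRG _ yR.
- exact: subsetP sRG _ zR.
- move=> i j k; rewrite -mulgA => h.
  have yzR : y ^+ j * z ^+ k \in R by rewrite groupM ?groupX.
  rewrite -[1%G : {set gT}]mulg1 in h.
  have [h1 h23] := dprod_mem_mulg defG (sub1G _) (sub1G _) (mem_cycle x i) yzR h.
  have [h2 h3] : (#[y] %| j)%N /\ (#[z] %| k)%N.
    by apply: (dprod2_expg_mem defR); rewrite ?cycle_expg_order ?mulg1.
  split; [rewrite -[2]ox | rewrite -[2]oy | rewrite -[2]oz] => //.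
  by apply: (dvdn_expg_mem_cycle (x := x)); rewrite ?cycle_expg_order.
by rewrite -(dprod_card defG) -(dprod_card defR) -!orderE ox oy oz cards1.
Qed.
End Sections.

(** The cyclic factors are grouped in pairs, with one group of three when their
    number is odd. *)
Lemma difference_matrix_bigdprod (gT : finGroupType) (G : {group gT}) b :
    abelian G -> \big[dprod/1]_(x <- b) <[x]> = G -> (1 < size b)%N ->
    (forall x, x \in b -> exists a, #[x] = (2 ^ a.+1)%N) ->
  has_difference_matrix G 1.
Proof.
have [n] := ubnP (size b); elim: n G b => // n IHn G b lt_bn cGG defG.
case: b lt_bn defG => [|x [|y b]] // lt_bn defG _ ob.
have [a ox] : exists a, #[x] = (2 ^ a.+1)%N by apply: ob; rewrite !inE eqxx.
have [c oy] : exists a, #[y] = (2 ^ a.+1)%N.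
  by apply: ob; rewrite !inE eqxx orbT.
rewrite 2!big_cons in defG.
case: b lt_bn defG ob => [|z [|w b]] lt_bn defG ob.
- by apply: (difference_matrix_cycle2 cGG _ ox oy); rewrite -defG big_nil dprodg1.
- have [e oz] : exists a, #[z] = (2 ^ a.+1)%N.
    by apply: ob; rewrite !inE eqxx !orbT.
  apply: (difference_matrix_cycle3 cGG _ ox oy oz).
  by rewrite -defG big_cons big_nil dprodg1.
rewrite dprodA in defG.
have [[P R defP defR] defG' _ _] := dprodP defG.
rewrite defP defR in defG defG'.
have sRG : R \subset G by rewrite -defG' mulG_subr.
have sPG : P \subset G by rewrite -defG' mulG_subl.
apply: (difference_matrix_trans cGG sRG (sub1G _)).
  apply: (difference_matrix_dprod defG cGG).
  exact: difference_matrix_cycle2 (abelianS sPG cGG) defP ox oy.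
apply: (IHn R (z :: w :: b) _ (abelianS sRG cGG)) => //.
  by move: lt_bn => /=; lia.
by move=> u ub; apply: ob; rewrite 2!in_cons ub !orbT.
Qed.

Lemma difference_matrix_noncyclic (gT : finGroupType) (G : {group gT}) :
  abelian G -> 2.-group G -> ~~ cyclic G -> has_difference_matrix G 1.
Proof.
move=> cGG pG ncG; have [b defG tb] := abelian_structure cGG.
have gt1 x : x \in b -> (1 < #[x])%N.
  by move=> xb; apply: (allP (abelian_type_gt1 G)); rewrite -tb map_f.
apply: (difference_matrix_bigdprod cGG defG).
  case: b defG ncG {tb gt1} => [|x [|y b]] //.
    by rewrite big_nil => <-; rewrite cyclic1.
  by rewrite big_cons big_nil dprodg1 => <-; rewrite cycle_cyclic.
move=> x xb; have xG : x \in G.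
  move: defG; rewrite (big_rem x xb) /= => /dprodP[[_ R _ ->] <- _ _].
  by rewrite (subsetP (mulG_subl _ _)) ?cycle_id.
have := mem_p_elt pG xG; rewrite /p_elt => /p_natP[[|a] ox]; last by exists a.
by have := gt1 x xb; rewrite ox.
Qed.
End NoncyclicAbelian.

(** * An elementary subgroup with noncyclic quotient *)

Section ElementaryKernel.
Local Open Scope group_scope.
Variable gT : finGroupType.
Implicit Types G E Z : {group gT}.

Lemma difference_matrix_quotient G E : E <| G ->
  has_difference_matrix (G / E) 1 -> has_difference_matrix G E.
Proof.
move=> nEG [T [f [cT fK fKK]]]; have [sEG nE] := andP nEG.
have reprG (c : coset_of E) : c \in G / E -> repr c \in G.
  move=> cG; rewrite -(quotientGK nEG) mem_morphpre ?repr_coset_norm //=.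
  by rewrite coset_reprK.
have lift (v : T -> gT) : (forall t, v t \in G) ->
    separates (G / E) 1 (fun t => coset E (v t)) -> separates G E v.
  move=> vG [_ hv]; split=> // t t' h; apply: hv.
  have nv s : v s \in 'N(E) by rewrite (subsetP nE).
  by rewrite -morphV // -morphM ?groupV //= coset_id ?group1.
have fG i t : repr (f i t) \in G by apply: reprG; case: (fK i).
exists T, (fun i t => repr (f i t)); split=> [|i|i j ij].
- by rewrite -(Lagrange sEG) -card_quotient // -cT cards1 muln1 mulnC.
- apply: lift => //; apply: eq_separates (fK i) => t.
  by rewrite coset_reprK.
apply: lift => [t|]; first by rewrite groupM ?groupV.
apply: eq_separates (fKK i j ij) => t.
by rewrite morphM ?groupV ?repr_coset_norm // morphV ?repr_coset_norm //=
  !coset_reprK.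
Qed.

Lemma exists_elementary_between G Z n : abelian G -> 2.-group G ->
    Z \subset 'Ohm_1(G) -> #|Z| = 2 -> (n < 'r(G))%N ->
  exists E : {group gT}, [/\ Z \subset E, E \subset G, 2.-abelem E
    & #|E| = (2 ^ n.+1)%N].
Proof.
move=> cGG pG sZO cZ ltn.
have sOG := Ohm_sub 1 G.
have abO := Ohm1_abelem pG cGG; have [pO cOO _] := and3P abO.
have nZO : Z <| 'Ohm_1(G).
  by rewrite /normal sZO cents_norm // (sub_abelian_cent2 cOO).
have cO : (n < logn 2 #|'Ohm_1(G)|)%N.
  by rewrite -p_rank_abelian // -(rank_pgroup pG).
have cOZ : (n <= logn 2 #|'Ohm_1(G) / Z|)%N.
  move: cO; rewrite -(Lagrange sZO) -card_quotient ?normal_norm //.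
  by rewrite lognM ?cardG_gt0 // cZ.
have pOZ := quotient_pgroup Z pO.
have [Q [sQ _ cQ]] := normal_pgroup pOZ (normal_refl _) cOZ.
have [E defQ sZE sEO] := inv_quotientS nZO sQ.
exists E; split=> //; first exact: subset_trans sEO sOG.
  exact: abelemS sEO abO.
have nZE : E \subset 'N(Z) := subset_trans sEO (normal_norm nZO).
by rewrite -(Lagrange sZE) -card_quotient // -defQ cQ cZ expnS.
Qed.

(** If G/E were generated by the class of h, comparing orders would force h to
    have order 2^(n+2), the exponent of G, and <[h]> to meet E trivially. Then x
    is h^a times an element of E, so that the involution x^(2^(n+1)) would lie
    in <[h]> as well as in E. *)
Lemma noncyclic_quotient G E x n :
    abelian G -> 2.-abelem E -> E <| G -> x \in G ->
    exponent G = #[x] -> (#[x] <= 2 ^ n.+2)%N -> #|G / E| = (2 ^ n.+2)%N ->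
    (#[x] = (2 ^ n.+2)%N -> x ^+ (2 ^ n.+1) \in E) ->
  ~~ cyclic (G / E).
Proof.
move=> cGG abE nEG xG expG lex cGE xE; have [sEG nE] := andP nEG.
apply/negP => /cyclicP[c defc].
have cG : c \in G / E by rewrite defc cycle_id.
have /morphimP[h nh hG def_c] := cG.
have oc : #[c] = (2 ^ n.+2)%N by rewrite orderE -defc.
have cX i : h ^+ i \in E -> (2 ^ n.+2 %| i)%N.
  move=> hi; rewrite -oc order_dvdn; apply/eqP.
  by rewrite def_c -morphX //= coset_id.
have hx : (#[h] %| #[x])%N by rewrite -expG dvdn_exponent.
have ch : (2 ^ n.+2 %| #[h])%N by apply: cX; rewrite expg_order group1.
have ox : #[x] = (2 ^ n.+2)%N.
  apply/eqP; rewrite eqn_leq lex dvdn_leq ?order_gt0 //.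
  exact: dvdn_trans ch hx.
have oh : #[h] = (2 ^ n.+2)%N.
  by apply/eqP; rewrite eqn_dvd ch -ox hx.
have nx : x \in 'N(E) by rewrite (subsetP nE).
have : coset E x \in <[c]> by rewrite -defc mem_quotient.
case/cycleP => a; rewrite def_c -morphX //= => cx.
have eE : x * (h ^+ a)^-1 \in E.
  apply: coset_idr; first by rewrite groupM ?groupV ?groupX.
  by rewrite morphM ?groupV ?groupX // morphV ?groupX //= cx mulgV.
have eX : (x * (h ^+ a)^-1) ^+ (2 ^ n.+1) = 1.
  have [_ E2] := abelemP (isT : prime 2) abE.
  by rewrite expnS expgM E2 ?expg1n.
have xX : x ^+ (2 ^ n.+1) = h ^+ (a * 2 ^ n.+1).
  rewrite -[in LHS](mulgKV (h ^+ a) x) expgMn ?eX ?mul1g ?expgM //.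
  by apply: (centsP cGG); rewrite ?groupM ?groupV ?groupX.
have := xE ox; rewrite xX => /cX dv.
have : (#[x] %| 2 ^ n.+1)%N.
  by rewrite order_dvdn xX -order_dvdn oh.
by rewrite ox dvdn_Pexp2l // ltnn.
Qed.

Lemma exists_elementary_difference_matrix G n : abelian G ->
    #|G| = (2 ^ (2 * n.+1 + 2))%N -> (n.+2 <= 'r(G))%N ->
    (exponent G <= 2 ^ n.+2)%N ->
  exists E : {group gT}, [/\ E \subset G, 2.-abelem E, #|E| = (2 ^ n.+2)%N
    & has_difference_matrix G E].
Proof.
move=> cGG oG rG eG.
have pG : 2.-group G by rewrite /pgroup oG pnatX.
have [x xG ex] := exponent_witness (abelian_nil cGG).
have ntG : (1 < #|G|)%N by rewrite oG (ltn_exp2l 0).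
have [[|e] ox] := p_natP (mem_p_elt pG xG).
  have := trivg_exponent G; rewrite ex ox dvdnn => /eqP G1.
  by rewrite G1 cards1 in ntG.
pose z := x ^+ (2 ^ e).
have oz : #[z] = 2.
  by rewrite orderXdiv ox expnS ?dvdn_mull // mulnK ?expn_gt0.
have zG : z \in G by rewrite groupX.
have zO : <[z]> \subset 'Ohm_1(G).
  by rewrite cycle_subG /= (OhmE 1 pG) mem_gen // !inE zG -oz expg_order eqxx.
have [E [zE sEG abE cE]] := exists_elementary_between cGG pG zO oz rG.
have nEG : E <| G by rewrite -sub_abelian_normal.
have cGE : #|G / E| = (2 ^ n.+2)%N.
  rewrite card_quotient ?normal_norm // -divgS // oG cE -expnB ?leq_addl //.
    by congr (2 ^ _)%N; lia.
  by lia.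
exists E; split=> //; apply: (difference_matrix_quotient nEG).
apply: difference_matrix_noncyclic; rewrite ?quotient_abelian ?quotient_pgroup //.
apply: (noncyclic_quotient cGG abE nEG xG ex _ cGE); first by rewrite -ex.
rewrite ox => /eqP; rewrite eqn_exp2l // => /eqP[<-].
by rewrite (subsetP zE) ?cycle_id.
Qed.
End ElementaryKernel.

(** * Coefficients in the group ring *)

Section GroupRing.
Import GRing.Theory Num.Theory.
Local Open Scope ring_scope.
Variable gT : finGroupType.
Implicit Types (x y : gT) (f g : group_ring gT) (G : {group gT}) (S : {set gT}).

Lemma gr_mulE f g x : (f * g) x = \sum_y f y * g (y^-1 * x)%g.
Proof. exact: ffunE. Qed.

Lemma gr_addE f g x : (f + g) x = f x + g x.
Proof. exact: ffunE. Qed.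

Lemma gr_oppE f x : (- f) x = - f x.
Proof. exact: ffunE. Qed.

Lemma gr_sumE (I : Type) (r : seq I) (P : pred I) (F : I -> group_ring gT) x :
  (\sum_(i <- r | P i) F i) x = \sum_(i <- r | P i) F i x.
Proof.
by apply: (big_morph (fun f : group_ring gT => f x)) => [f g|]; apply: ffunE.
Qed.

Lemma gr_mulrnE f n x : (f *+ n) x = f x *+ n.
Proof.
by elim: n => [|n IHn]; rewrite ?mulr0n ?ffunE // !mulrS gr_addE IHn.
Qed.

Lemma gr_mulrzE f (m : int) x : (f *~ m) x = f x *~ m.
Proof. by case: m => n; rewrite ?NegzE ?mulrNz ?gr_oppE -!pmulrn gr_mulrnE. Qed.

Lemma gr_eltE x y : gr_elt x y = (y == x)%:R.
Proof. exact: ffunE. Qed.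

Lemma gr_elt_mull x f y : (gr_elt x * f) y = f (x^-1 * y)%g.
Proof.
rewrite gr_mulE (bigD1 x) //= gr_eltE eqxx mul1r big1 ?addr0 // => z /negPf zx.
by rewrite gr_eltE zx mul0r.
Qed.

Lemma gr_elt_mulr x f y : (f * gr_elt x) y = f (y * x^-1)%g.
Proof.
rewrite gr_mulE (bigD1 (y * x^-1)%g) //= gr_eltE invMg invgK mulgKV eqxx mulr1.
rewrite big1 ?addr0 // => z zx; rewrite gr_eltE; case: eqP => [e|_].
  by case/eqP: zx; rewrite -e invMg invgK mulKVg.
by rewrite mulr0.
Qed.

Lemma gr_eltM x y : gr_elt x * gr_elt y = gr_elt (x * y)%g :> group_ring gT.
Proof.
apply/ffunP=> z; rewrite gr_elt_mull !gr_eltE; congr (nat_of_bool _)%:R.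
by apply/eqP/eqP => [<-|->]; rewrite ?mulKVg ?mulKg.
Qed.

Lemma gr_setE S x : gr_set S x = (x \in S)%:R.
Proof.
rewrite gr_sumE; under eq_bigr do rewrite gr_eltE eq_sym.
case: (boolP (x \in S)) => xS; last first.
  by rewrite big1 // => y yS; case: eqP => // e; rewrite -e yS in xS.
rewrite (bigD1 x) //= eqxx big1 ?addr0 // => y /andP[_ /negPf yx].
by rewrite yx.
Qed.

Lemma augmentation_gr_set S : \sum_x gr_set S x = #|S|%:R.
Proof.
rewrite -sum1_card natr_sum [RHS]big_mkcond /=; apply: eq_bigr => x _.
by rewrite gr_setE; case: (x \in S).
Qed.

Lemma gr_setVE S x : gr_setV S x = (x^-1%g \in S)%:R.
Proof.
rewrite -gr_setE !gr_sumE; apply: eq_bigr => y _; rewrite !gr_eltE.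
by rewrite -(inj_eq invg_inj) invgK.
Qed.

(** Multiplying by the sum of all elements of G only sees the augmentation. *)
Lemma gr_set_mul_group G f : (forall x, x \notin G -> f x = 0) ->
  gr_set G * f = gr_set G *~ (\sum_x f x).
Proof.
move=> fG; apply/ffunP=> x; rewrite gr_mulrzE gr_mulE gr_setE.
rewrite (reindex (fun y => x * y^-1)%g) /=; last first.
  by exists (fun y => y^-1 * x)%g => y _;
    rewrite invMg invgK ?mulgKV ?mulKVg ?mulKg.
rewrite -mulrzr intz mulr_sumr; apply: eq_bigr => y _.
rewrite gr_setE invMg invgK mulgKV; case: (boolP (y \in G)) => yG.
  by rewrite groupMr ?groupV.
by rewrite fG // !mulr0.
Qed.

Lemma gr_mul_set_group G f : (forall x, x \notin G -> f x = 0) ->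
  f * gr_set G = gr_set G *~ (\sum_x f x).
Proof.
move=> fG; apply/ffunP=> x; rewrite gr_mulrzE gr_mulE gr_setE.
rewrite -mulrzr intz mulr_sumr; apply: eq_bigr => y _.
rewrite gr_setE mulrC; case: (boolP (y \in G)) => yG.
  by rewrite groupMl ?groupV.
by rewrite fG // !mulr0.
Qed.

(** This turns the counting condition defining a difference set into an
    identity between coefficients in the group ring. *)
Lemma card_difference_pairs S x : x != 1%g ->
  #|[set p in setX S S | (p.1 != p.2) && (p.1 * p.2^-1 == x)%g]|%:Z
    = (gr_set S * gr_setV S) x.
Proof.
move=> x1; rewrite gr_mulE.
under eq_bigr => y _ do rewrite gr_setE gr_setVE invMg invgK -natrM mulnb.
have -> : [set p in setX S S | (p.1 != p.2) && (p.1 * p.2^-1 == x)%g] =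
    [set (y, x^-1 * y)%g | y in [pred y | (y \in S) && (x^-1 * y \in S)%g]].
  apply/setP=> [[a b]]; rewrite !inE /=; apply/idP/imsetP.
    case/andP=> /andP[aS bS] /andP[_ /eqP <-].
    by exists a; rewrite ?inE invMg invgK mulgKV ?aS.
  case=> y; rewrite inE => /andP[yS xyS] [-> ->]; rewrite yS xyS /=.
  rewrite invMg invgK mulKVg eqxx andbT; apply: contraNneq x1 => e.
  by rewrite -invg_eq1; apply/eqP/(mulIg y); rewrite -e mul1g.
rewrite card_imset => [|a b []] //.
rewrite -natz -sum1_card natr_sum big_mkcond /=.
by apply: eq_bigr => y _; rewrite inE; case: (_ && _).
Qed.
End GroupRing.

(** * Sign characters of elementary abelian 2-groups *)

Section SignCharacters.
Import GRing.Theory Num.Theory.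
Local Open Scope ring_scope.

(** The characters of an elementary abelian 2-group, extended by 0, kept as an
    indexed family because they have to be matched with the columns of a
    difference matrix. Both orthogonality relations are recorded. *)
Definition sign_characters (gT : finGroupType) (E : {set gT}) (T : finType)
    (chi : T -> group_ring gT) : Prop :=
  [/\ forall t x, x \notin E -> chi t x = 0,
      forall t x, x \in E -> chi t x = 1 \/ chi t x = -1,
      forall t, {in E &, {morph chi t : x y / (x * y)%g >-> x * y}},
      forall t s, \sum_(x in E) chi t x * chi s x = #|E|%:R *+ (t == s)
    & forall x, x \in E -> \sum_t chi t x = #|E|%:R *+ (x == 1%g)].

(** Translating w by a basis vector that pairs to 1 with v changes the sign of
    every term. *)
Lemma sum_sign_pairing n (v : 'rV['F_2]_n) :
  \sum_(w : 'rV_n) (-1) ^+ ((v *m w^T) 0 0 : 'F_2) =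
    #|'rV['F_2]_n|%:R *+ (v == 0%R) :> int.
Proof.
have signD (a b : 'F_2) : (-1) ^+ (a + b)%R = (-1) ^+ a * (-1) ^+ b :> int.
  by case: a b => [[|[|a]] lta] [[|[|b]] ltb].
case: eqP => [->|/eqP v0].
  under eq_bigr => w _ do rewrite mul0mx mxE.
  by rewrite sumr_const mulr1n.
have [i vi] : exists i, v 0 i != 0 by apply/rV0Pn.
have v1 : v 0 i = 1.
  by apply/val_inj; move: vi; case: (v 0 i) => [[|[|a]] lta].
set S := \sum_w _; suff : S = - S by move=> e; rewrite mulr0n; lia.
rewrite {1}/S (reindex_inj (addIr (delta_mx 0 i))) /= -sumrN.
apply: eq_bigr => w _; rewrite linearD /= mulmxDr mxE signD.
by rewrite trmx_delta -colE [col i v 0 0]mxE v1 /= expr1 mulrN1.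
Qed.

(** Identify E with a space of row vectors over F_2: the characters are the
    signs of the pairings with a fixed vector, and by symmetry of the pairing
    one exponential sum yields both orthogonality relations. *)
Lemma exists_sign_characters (gT : finGroupType) (E : {group gT}) :
    2.-abelem%g E -> E :!=: 1%g ->
  exists (T : finType) (chi : T -> group_ring gT),
    #|T| = #|E| /\ sign_characters E chi.
Proof.
move=> abE ntE; pose rV := abelem_rV abE ntE.
have rVM : {in E &, {morph rV : x y / (x * y)%g >-> x + y}}.
  exact: abelem_rV_M.
pose T : finType := 'rV['F_2]_(abelem_dim' E).+1.
pose sgn (v w : T) : int := (-1) ^+ ((v *m w^T) 0 0 : 'F_2).
have sgnD (v w w' : T) : sgn v (w + w') = sgn v w * sgn v w'.
  rewrite /sgn linearD mulmxDr mxE /=.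
  by case: (_ 0 0) (_ 0 0) => [[|[|a]] lta] [[|[|b]] ltb].
have sgnC v w : sgn v w = sgn w v.
  by rewrite /sgn -[in LHS](trmxK v) -trmx_mul mxE.
have cT : #|T| = #|E| by apply: card_abelem_rV.
have sumE (F : T -> int) : \sum_(x in E) F (rV x) = \sum_w F w.
  rewrite (reindex (rVabelem abE ntE)) /=.
    apply: eq_big => w; first by rewrite mem_rVabelem.
    by rewrite /rV rVabelemK.
  exists rV => x; rewrite inE => xE; [exact: rVabelemK | exact: abelem_rV_K].
exists T, (fun v => [ffun x => if x \in E then sgn v (rV x) else 0]).
split=> //; split.
- by move=> v x /negPf xE; rewrite ffunE xE.
- move=> v x xE; rewrite ffunE xE /sgn -signr_odd.
  by case: (odd _); [right | left].
- by move=> v x y xE yE; rewrite !ffunE groupM // xE yE rVM // sgnD.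
- move=> v w; under eq_bigr => x xE do
    rewrite !ffunE xE sgnC [sgn w _]sgnC -sgnD sgnC.
  rewrite (sumE (sgn (v + w))) sum_sign_pairing cT.
  congr (_ *+ nat_of_bool _); rewrite -[v == w]subr_eq0.
  (* w = - w over F_2 *)
  congr (_ + _ == _); apply/matrixP=> i j; rewrite mxE.
  by case: (w i j) => [[|[|m]] ltm]; apply/val_inj.
move=> x xE; under eq_bigr => v _ do rewrite ffunE xE sgnC.
rewrite sum_sign_pairing cT; congr (_ *+ nat_of_bool _).
have <- : rV 1%g = 0 by apply: abelem_rV_1.
by apply/eqP/eqP => [|-> //]; apply: abelem_rV_inj.
Qed.
End SignCharacters.

(** * Difference sets from transversals *)

Section TwistedCharacterSums.
Import GRing.Theory Num.Theory.
Local Open Scope ring_scope.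
Variables (gT : finGroupType) (G E : {group gT}) (T : finType).
Variable chi : T -> group_ring gT.
Hypotheses (abelG : abelian G) (sEG : E \subset G) (abelE : 2.-abelem%g E).
Hypotheses (cardT : #|T| = #|E|) (cardG : (#|T| * #|E|)%N = #|G|).
Hypothesis chiP : sign_characters E chi.
Implicit Types (u v : T -> gT) (t s : T) (x y : gT).

Let chi_out t x : x \notin E -> chi t x = 0.
Proof. by case: chiP => h _ _ _ _; apply: h. Qed.

Let inv_E x : x \in E -> x^-1%g = x.
Proof.
have [_ E2] := abelemP (isT : prime 2) abelE; move=> xE.
by apply/eqP; rewrite eq_invg_mul -[(x * x)%g]/(x ^+ 2)%g E2.
Qed.

Lemma sign_character_inv t x : chi t x^-1%g = chi t x.
Proof.
case: (boolP (x \in E)) => [/inv_E->//|xE].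
by rewrite !chi_out // groupV.
Qed.

(** Up to the factor |E|, the characters are orthogonal idempotents. *)
Lemma sign_character_conv t s : chi t * chi s = chi t *+ (#|E| * (t == s)).
Proof.
have [_ _ chiM chi_orth _] := chiP.
apply/ffunP=> x; rewrite gr_mulE gr_mulrnE.
rewrite (bigID (mem E)) /= addrC big1 ?add0r => [|y /chi_out->]; last first.
  by rewrite mul0r.
case: (boolP (x \in E)) => xE; last first.
  rewrite chi_out // mul0rn big1 // => y yE.
  by rewrite (chi_out s) ?mulr0 // groupMl ?groupV.
under eq_bigr => y yE do rewrite chiM ?groupV // sign_character_inv mulrA.
rewrite -mulr_suml chi_orth; case: eqP => [->|_]; last by rewrite muln0 mul0r.
by rewrite muln1 mulr1n mulr_natl.
Qed.

Lemma sum_sign_characters : \sum_t chi t = gr_elt 1%g *+ #|E|.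
Proof.
have [_ _ _ _ chi_dual] := chiP.
apply/ffunP=> x; rewrite gr_sumE gr_mulrnE gr_eltE.
case: (boolP (x \in E)) => xE; last first.
  rewrite big1 => [|t _]; last exact: chi_out.
  by case: eqP xE => [->|]; rewrite ?group1 ?mul0rn.
by rewrite chi_dual //; case: eqP; rewrite ?mul0rn.
Qed.

Lemma sign_character_comm t x : x \in G ->
  chi t * gr_elt x = gr_elt x * chi t.
Proof.
move=> xG; apply/ffunP=> y; rewrite gr_elt_mull gr_elt_mulr.
case: (boolP (y \in G)) => yG.
  by rewrite (centsP abelG y yG) ?groupV.
rewrite !chi_out //; apply: contra yG => /(subsetP sEG).
  by rewrite groupMl ?groupV.
by rewrite groupMr ?groupV.
Qed.

Definition twisted_sum u : group_ring gT := \sum_t gr_elt (u t) * chi t.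

(** The image of [twisted_sum u] under inversion in G, written so that the
    products in [twisted_sum_mul] telescope; see [twisted_sum_invE]. *)
Definition twisted_sum_inv u : group_ring gT :=
  \sum_t chi t * gr_elt (u t)^-1%g.

(** Expanding the product, orthogonality kills the terms with distinct indices,
    and commutativity of G brings u_t and v_t^-1 together in the others. *)
Lemma twisted_sum_mul u v : (forall t, u t \in G) -> (forall t, v t \in G) ->
  twisted_sum u * twisted_sum_inv v
    = twisted_sum (fun t => u t * (v t)^-1)%g *+ #|E|.
Proof.
move=> uG vG; rewrite /twisted_sum mulr_suml -sumrMnl; apply: eq_bigr => t _.
rewrite mulr_sumr (bigD1 t) //= big1 ?addr0 => [|s st].
  rewrite mulrA -(mulrA _ (chi t) (chi _)) sign_character_conv eqxx muln1.
  rewrite mulrnAr mulrnAl -mulrA sign_character_comm ?groupV // mulrA.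
  by rewrite gr_eltM.
rewrite mulrA -(mulrA _ (chi t) (chi _)) sign_character_conv eq_sym.
by rewrite (negPf st) muln0 mulr0n mulr0 mul0r.
Qed.

Lemma twisted_sum_mul_self u : (forall t, u t \in G) ->
  twisted_sum u * twisted_sum_inv u = gr_elt 1%g *+ (#|E| * #|E|).
Proof.
move=> uG; rewrite twisted_sum_mul // mulrnA -sum_sign_characters.
congr (_ *+ _); apply: eq_bigr => t _.
by rewrite mulgV [gr_elt 1%g]/(1 : group_ring gT) mul1r.
Qed.

Lemma twisted_sum_invE u x : twisted_sum_inv u x = twisted_sum u x^-1%g.
Proof.
rewrite !gr_sumE; apply: eq_bigr => t _.
by rewrite gr_elt_mull gr_elt_mulr -invMg sign_character_inv invgK.
Qed.

Lemma twisted_sum_out u x : (forall t, u t \in G) -> x \notin G ->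
  twisted_sum u x = 0.
Proof.
move=> uG xG; rewrite gr_sumE big1 // => t _; rewrite gr_elt_mull chi_out //.
by apply: contra xG => /(subsetP sEG); rewrite groupMl ?groupV.
Qed.

Lemma augmentation_twisted_sum u : \sum_x twisted_sum u x = #|E|%:R.
Proof.
under eq_bigr => x _ do rewrite gr_sumE.
rewrite exchange_big /=.
under eq_bigr => t _.
  rewrite (reindex_inj (mulgI (u t))) /=.
  under eq_bigr => x _ do rewrite gr_elt_mull mulKg.
  over.
rewrite exchange_big /= (eq_bigr (gr_elt 1%g *+ #|E| : group_ring gT)).
  rewrite (bigD1 1%g) //= gr_mulrnE gr_eltE eqxx big1 ?addr0 // => x /negPf x1.
  by rewrite gr_mulrnE gr_eltE x1 mul0rn.
by move=> x _; rewrite -sum_sign_characters gr_sumE.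
Qed.

(** The products u_t e are pairwise distinct, and there are #|G| of them. *)
Lemma separates_cover u x : separates G E u -> x \in G ->
  exists t, ((u t)^-1 * x)%g \in E.
Proof.
move=> [uG hu] xG.
pose f (p : T * gT) := (u p.1 * p.2)%g.
have injf : {in setX setT E &, injective f}.
  move=> [t e] [t' e']; rewrite !inE /= => eE e'E ee.
  have tt' : t = t'.
    apply: hu; have -> : (u t * (u t')^-1 = e' * e^-1)%g; last first.
      by rewrite groupM ?groupV.
    have ut : u t = (u t' * (e' * e^-1))%g.
      by rewrite mulgA -[(u t' * e')%g]ee mulgK.
    have eG : (e' * e^-1)%g \in G by rewrite (subsetP sEG) ?groupM ?groupV.
    by rewrite ut (centsP abelG (u t')) // mulgK.
  by move: ee; rewrite /f tt' /= => /mulgI->.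
have : f @: setX setT E = G.
  apply/eqP; rewrite eqEcard card_in_imset // cardsX cardsT cardG leqnn andbT.
  apply/subsetP=> _ /imsetP[[t e] /setXP[_ eE] ->].
  by rewrite groupM // (subsetP sEG).
move/setP/(_ x); rewrite xG => /imsetP[[t e] /setXP[_ eE] ->].
by exists t; rewrite mulKg.
Qed.

(** Exactly one of the translates u_t E contains x, so exactly one term of the
    sum contributes to the coefficient of x. *)
Lemma twisted_sum_sign u x : separates G E u -> x \in G ->
  twisted_sum u x = 1 \/ twisted_sum u x = -1.
Proof.
move=> su xG.
have [t tE] := separates_cover su xG; have [uG hu] := su.
have -> : twisted_sum u x = chi t ((u t)^-1 * x)%g.
  rewrite gr_sumE (bigD1 t) //= gr_elt_mull big1 ?addr0 // => s st.
  rewrite gr_elt_mull chi_out //; apply: contra st => sE; apply/eqP/hu.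
  rewrite (centsP abelG (u s)) ?groupV //.
  have -> : ((u t)^-1 * u s = ((u t)^-1 * x) * ((u s)^-1 * x)^-1)%g.
    by rewrite invMg invgK mulgA mulgK.
  by rewrite groupM ?groupV.
by case: chiP => _ h _ _ _; apply: h.
Qed.

Definition twisted_set u : {set gT} := [set x in G | twisted_sum u x == -1].

Lemma twisted_setE u : separates G E u ->
  gr_set (twisted_set u) *+ 2 = gr_set G - twisted_sum u.
Proof.
move=> su; have [uG _] := su; apply/ffunP=> x.
rewrite gr_mulrnE gr_addE gr_oppE !gr_setE inE.
case: (boolP (x \in G)) => xG /=; last by rewrite twisted_sum_out // subr0.
by case: (twisted_sum_sign su xG) => ->.
Qed.

Lemma twisted_setVE u : separates G E u ->
  gr_setV (twisted_set u) *+ 2 = gr_set G - twisted_sum_inv u.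
Proof.
move=> su; apply/ffunP=> x; have /ffunP/(_ x^-1%g) := twisted_setE su.
rewrite !gr_mulrnE !gr_addE !gr_oppE !gr_setE gr_setVE groupV => ->.
by rewrite twisted_sum_invE.
Qed.

(** Expand (G - S_u)(G - S_v^(-1)), where each S has augmentation |E|. *)
Lemma gr_twisted_set_mul u v : separates G E u -> separates G E v ->
  (gr_set (twisted_set u) * gr_setV (twisted_set v)) *+ 4 =
    gr_set G *~ (#|G|%:Z - 2 * #|E|%:Z) + twisted_sum u * twisted_sum_inv v.
Proof.
move=> su sv; have [[uG _] [vG _]] := (su, sv).
have -> : gr_set (twisted_set u) * gr_setV (twisted_set v) *+ 4 =
    (gr_set (twisted_set u) *+ 2) * (gr_setV (twisted_set v) *+ 2).
  by rewrite mulrnAl mulrnAr -mulrnA.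
rewrite twisted_setE // twisted_setVE // mulrBl !mulrBr.
rewrite (gr_mul_set_group (fun x => @twisted_sum_out u x uG)) augmentation_twisted_sum.
rewrite (gr_set_mul_group (f := twisted_sum_inv v)) => [|x xG]; last first.
  by rewrite twisted_sum_invE twisted_sum_out // groupV.
rewrite (gr_set_mul_group (f := gr_set G)) => [|x /negPf xG]; last first.
  by rewrite gr_setE xG.
have -> : \sum_x twisted_sum_inv v x = #|E|%:R.
  rewrite -(augmentation_twisted_sum v) (reindex_inj invg_inj) /=.
  by apply: eq_bigr => x _; rewrite twisted_sum_invE invgK.
rewrite augmentation_gr_set.
have -> : #|G|%:Z - 2 * #|E|%:Z = #|G|%:Z - #|E|%:Z - #|E|%:Z by lia.
by rewrite !natz !mulrzBr opprB addrA addrAC.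
Qed.

Lemma card_twisted_set u : separates G E u ->
  (2 * #|twisted_set u| + #|E|)%N = #|G|.
Proof.
move=> su; have : \sum_x (gr_set (twisted_set u) *+ 2) x =
    \sum_x (gr_set G - twisted_sum u) x by rewrite twisted_setE.
under eq_bigr do rewrite gr_mulrnE.
under [in RHS]eq_bigr do rewrite gr_addE gr_oppE.
rewrite sumrMnl sumrB augmentation_twisted_sum !augmentation_gr_set.
rewrite mulr2n !natz => h.
have {}h : #|twisted_set u|%:Z + #|twisted_set u|%:Z = #|G|%:Z - #|E|%:Z.
  exact: h.
by lia.
Qed.

Lemma twisted_set_difference_set u m : separates G E u -> #|E| = (2 * m)%N ->
  difference_set (4 * (m * m)) (m * (2 * m - 1)) (m * (m - 1)) (m * m) G
    (twisted_set u).
Proof.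
move=> su cE; have [uG _] := su.
have cG : #|G| = (4 * (m * m))%N by rewrite -cardG cardT cE; lia.
have m0 : (0 < m)%N by have := cardG_gt0 E; rewrite cE; lia.
have := card_twisted_set su; rewrite cE cG => ck.
have ek : (m * (2 * m - 1) = 2 * (m * m) - m)%N by rewrite mulnBr muln1 mulnCA.
have el : (m * (m - 1) = m * m - m)%N by rewrite mulnBr muln1.
have mm : (m <= m * m)%N by rewrite leq_pmulr.
rewrite ek el; split=> //.
- by apply/subsetP=> x; rewrite inE => /andP[].
- by lia.
- by lia.
move=> x /setD1P[x1 xG]; have := card_difference_pairs (twisted_set u) x1.
have /ffunP/(_ x) := gr_twisted_set_mul su su.
rewrite twisted_sum_mul_self // gr_mulrnE gr_addE !gr_mulrnE gr_mulrzE gr_setE xG.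
rewrite gr_eltE (negPf x1) mul0rn addr0 cG cE => + e.
rewrite -e mulrzz -mulr_natr !natz => h.
by lia.
Qed.

(** With |E| = 4m, substituting S_{u/v} = G - 2 D_{u/v} in the expansion of
    4 D_u D_v^(-1) leaves coefficients divisible by 4; for |E| = 2 they would
    not be. *)
Lemma twisted_set_link u v m : separates G E u -> separates G E v ->
    separates G E (fun t => u t * (v t)^-1)%g -> #|E| = (4 * m)%N ->
  gr_set (twisted_set u) * gr_setV (twisted_set v) =
    gr_set (twisted_set (fun t => u t * (v t)^-1)%g) *~ (- (2 * m)%:Z)
      + gr_set G *~ (4 * (m * m) - m)%:Z.
Proof.
move=> su sv suv cE; have [[uG _] [vG _]] := (su, sv).
have cG : #|G| = (16 * (m * m))%N by rewrite -cardG cardT cE; lia.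
apply/ffunP=> x; have /ffunP/(_ x) := gr_twisted_set_mul su sv.
have /ffunP/(_ x) := twisted_setE suv.
rewrite twisted_sum_mul // !gr_mulrnE !gr_addE !gr_mulrzE gr_mulrnE gr_oppE.
have mm : (m <= m * m)%N by case: (m) => // k; rewrite leq_pmulr.
have mulrn_int (a : int) n : a *+ n = a * n%:Z by rewrite -mulr_natr natz.
rewrite cE cG !mulrzz !mulrn_int.
set p := (gr_set _ * gr_setV _) x; set d := gr_set _ x.
set s := twisted_sum _ x; set g := gr_set G x => e1 e2.
have {}e1 : s = g - d * 2 by rewrite [d * 2]e1 subKr.
apply: (@mulIf _ (4%:Z)) => //; rewrite [LHS]e2 e1 -subzn ?leq_pmull //.
  by rewrite !PoszM; ring.
by lia.
Qed.

(** If D_u = D_v then S_u S_v^(-1) = S_u S_u^(-1) has coefficient |E|^2 at the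
    identity, whereas |E| S_{u/v} has coefficient |E| or -|E| there. *)
Lemma twisted_set_inj u v : separates G E u -> separates G E v ->
    separates G E (fun t => u t * (v t)^-1)%g -> (1 < #|E|)%N ->
  twisted_set u <> twisted_set v.
Proof.
move=> su sv suv E1 e; have [[uG _] [vG _]] := (su, sv).
have Suv : twisted_sum_inv u = twisted_sum_inv v.
  by apply/(can_inj (subKr (gr_set G))); rewrite -!twisted_setVE // e.
have /ffunP/(_ 1%g) := twisted_sum_mul uG vG.
rewrite -Suv twisted_sum_mul_self // !gr_mulrnE gr_eltE eqxx.
have lt_EE : (#|E| < #|E| * #|E|)%N by rewrite -[X in (X < _)%N]muln1 ltn_pmul2l.
case: (twisted_sum_sign suv (group1 G)) => ->; rewrite ?mulNrn !natz => h.
  by have {}h : (#|E| * #|E|)%N%:Z = #|E|%:Z := h; lia.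
by have {}h : (#|E| * #|E|)%N%:Z = - #|E|%:Z := h; lia.
Qed.

End TwistedCharacterSums.

(** * The linking system *)

Section LinkingSystem.
Import GRing.Theory.
Local Open Scope ring_scope.

Lemma linking_system_of_difference_matrix (gT : finGroupType)
    (G E : {group gT}) m :
    abelian G -> E \subset G -> 2.-abelem%g E -> (0 < m)%N ->
    #|E| = (4 * m)%N -> #|G| = (#|E| * #|E|)%N -> has_difference_matrix G E ->
  exists DD : {set {set gT}},
    reduced_linking_system (4 * (2 * m * (2 * m))) (2 * m * (2 * (2 * m) - 1))
      (2 * m * (2 * m - 1)) (2 * m * (2 * m)) 3 G DD.
Proof.
move=> cGG sEG abE m0 cE cG [T [f [cT sepf sepff]]].
have ntE : E :!=: 1%g by rewrite -cardG_gt1 cE; lia.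
have [U [chi [cU chiP]]] := exists_sign_characters abE ntE.
have cTE : #|T| = #|E|.
  by apply/eqP; rewrite -(eqn_pmul2r (cardG_gt0 E)) cT cG.
(* The columns of the matrix are matched arbitrarily with the characters. *)
have [h inj_h] : exists h : U -> T, injective h.
  have cUT : #|U| = #|T| by rewrite cU cTE.
  exists (fun t => enum_val (cast_ord cUT (enum_rank t))).
  by move=> s t /enum_val_inj/cast_ord_inj/enum_rank_inj.
have sep_h (u : T -> gT) : separates G E u -> separates G E (u \o h).
  by move=> [uG hu]; split=> [t|s t /hu/inj_h] //; apply: uG.
pose u i := f i \o h.
have su i : separates G E (u i) by apply: sep_h.
have suv i j : i != j -> separates G E (fun t => u i t * (u j t)^-1)%g.
  by move=> ij; apply: (sep_h _ (sepff i j ij)).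
pose D v := twisted_set G chi v.
have cE2 : #|E| = (2 * (2 * m))%N by rewrite cE; lia.
have cUG : (#|U| * #|E|)%N = #|G| by rewrite cU cG.
have diffD v : separates G E v -> difference_set (4 * (2 * m * (2 * m)))
    (2 * m * (2 * (2 * m) - 1)) (2 * m * (2 * m - 1)) (2 * m * (2 * m)) G (D v).
  move=> sv; exact: (twisted_set_difference_set cGG sEG abE cU cUG chiP sv cE2).
have injD : injective (fun i => D (u i)).
  move=> i j eD; apply/eqP; apply: contraT => ij.
  have E1 : (1 < #|E|)%N by rewrite cardG_gt1.
  by case: (twisted_set_inj cGG sEG abE cU cUG chiP (su i) (su j) (suv i j ij) E1).
exists [set D (u i) | i : 'I_3]; split=> //.
- by rewrite card_imset // card_ord.
- by move=> _ /imsetP[i _ ->]; apply: diffD.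
(* Read off from [twisted_set_link]: mu - nu = -2m and nu = 4m^2 - m. *)
exists ((4 * (m * m) - m)%N%:Z - (2 * m)%N%:Z), (4 * (m * m) - m)%N%:Z.
move=> _ _ /imsetP[i _ ->] /imsetP[j _ ->] neq.
have ij : i != j by apply: contraNneq neq => ->.
exists (D (fun t => u i t * (u j t)^-1)%g); first by apply/diffD/suv.
rewrite (twisted_set_link cGG sEG abE cU cUG chiP (su i) (su j) (suv i j ij) cE).
by rewrite addrAC subrr add0r.
Qed.

Lemma singleton_linking_system (gT : finGroupType) (G : {group gT}) :
  #|G| = 4 -> exists DD, reduced_linking_system 4 1 0 1 3 G DD.
Proof.
move=> cG.
have diff x : x \in G -> difference_set 4 1 0 1 G [set x].
  move=> xG; split=> //; rewrite ?sub1set ?cards1 // => g _.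
  apply/eqP; rewrite cards_eq0 -subset0; apply/subsetP=> [[a b]].
  by rewrite !inE /= => /andP[/andP[/eqP-> /eqP->]]; rewrite eqxx.
exists [set [set x] | x in G^#%g]; split=> //.
- rewrite card_imset; last exact: set1_inj.
  by have := cardsD1 1%g G; rewrite group1 cG => -[].
- by move=> _ /imsetP[x /setD1P[_ xG] ->]; apply: diff.
exists 1, 0 => _ _ /imsetP[x /setD1P[_ xG] ->] /imsetP[y /setD1P[_ yG] ->] _.
exists [set (x * y^-1)%g]; first by apply: diff; rewrite groupM ?groupV.
by rewrite /gr_set /gr_setV !big_set1 gr_eltM subr0 mulr1z mulr0z addr0.
Qed.
End LinkingSystem.
Unset Implicit Arguments.

Theorem corollary5p8 (d : nat) (gT : finGroupType) (G : {group gT})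
  (abelG : abelian G)
  (orderG : #|G| = (2 ^ (2 * d + 2))%N)
  (rankG : (d + 1 <= 'r(G)%g)%N)
  (exponentG : (exponent G <= 2 ^ (d + 1))%N) :
  exists DD : {set {set gT}},
    reduced_linking_system
      (2 ^ (2 * d + 2))%N (2 ^ d * (2 ^ (d + 1) - 1))%N
      (2 ^ d * (2 ^ d - 1))%N (2 ^ (2 * d))%N 3 G DD.
Proof.
case: d orderG rankG exponentG => [|n] orderG rankG exponentG.
  exact: singleton_linking_system.
rewrite addn1 in rankG exponentG.
have [E [sEG abE cE dmE]] :=
  exists_elementary_difference_matrix abelG orderG rankG exponentG.
have cE4 : #|E| = (4 * 2 ^ n)%N by rewrite cE !expnS mulnA.
have cG : #|G| = (#|E| * #|E|)%N.
  by rewrite orderG cE -expnD; congr (2 ^ _)%N; lia.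
have n0 : (0 < 2 ^ n)%N by rewrite expn_gt0.
have := linking_system_of_difference_matrix abelG sEG abE n0 cE4 cG dmE.
have -> : (2 ^ (2 * n.+1) = 2 ^ n.+1 * 2 ^ n.+1)%N by rewrite -expnD addnn mul2n.
have -> : (2 ^ (2 * n.+1 + 2) = 4 * (2 ^ n.+1 * 2 ^ n.+1))%N.
  by rewrite -[in RHS]expnD addnn -mul2n expnD mulnC.
by rewrite addn1 (expnS 2 n.+1) (expnS 2 n).
Qed.
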